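(* Let $\varphi\in\Gamma(\mathbb{R}^n)$ achieve its minimum $\min\varphi$, and let $\mathrm{crit}\,\varphi$ be nonempty and closed. Let $X\subset\mathbb{R}^n$, $\Omega\subset X$, and let $G_\varphi:X\to\mathbb{R}^n$ be a residual measure operator related to $\varphi$ and $X$. Suppose that $\varphi$ satisfies the $(G_\varphi,\beta,\Omega)$-(cor-res-EB) condition. Define the abstract gradient-type method by $$x_{k+1}=x_k-h\cdot G_\varphi(x_k),\quad k\ge0,$$ with step size $h>0$ and arbitrary initial point $x_0\in\Omega$. Assume that $x_k\in\Omega$ for all $k\ge0$. Let $\tau,\theta\in(0,1)$. (i) If $\varphi$ satisfies the $(G_\varphi,\nu,\Omega)$-(cor-EB) condition with $\nu<\frac1\beta$ and $$\frac{1-\tau}{2\theta\nu}\le h\le2(1-\theta)\beta,\qquad \tau\ge1-4\theta(1-\theta)\beta\nu,$$ then the method converges linearly in the sense that $$d^2(x_{k+1},\mathrm{crit}\,\varphi)\le\tau\cdot d^2(x_k,\mathrm{crit}\,\varphi),\quad k\ge0. \qquad( * )$$ The optimal (smallest) rate $\tau_0:=1-\beta\nu$ permitted by these inequalities is obtained at $h=\beta$ and $\theta=\frac12$. (ii) Conversely, if the method (started from an arbitrary $x_0\in\Omega$) converges linearly in the sense of $( * )$, then $\varphi$ satisfies the $(G_\varphi,\nu,\Omega)$-(cor-EB) condition with $\nu=\frac{\beta(1-\sqrt\tau)^2}{h^2}$.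
   Context: $\Gamma(\mathbb{R}^n)$ is the class of proper lower semicontinuous functions $\mathbb{R}^n\to(-\infty,+\infty]$. $\mathrm{dom}\,\varphi=\{x:\varphi(x)<+\infty\}$. $\partial\varphi$ is the limiting subdifferential and $\mathrm{crit}\,\varphi=\{x:0\in\partial\varphi(x)\}$. $d(x,Q)=\inf_{y\in Q}\|x-y\|$, and $\mathcal{P}_\varphi(x)$ is the set of points $u\in\mathrm{crit}\,\varphi$ minimizing $\|x-u\|$. A map $G_\varphi:X\to\mathbb{R}^n$ is a residual measure operator related to $\varphi$ and $X$ if $\{x\in X:G_\varphi(x)=0\}=\mathrm{crit}\,\varphi$. For $\Omega\subset X$ and constants $\nu,\beta>0$ (each condition required for all $x\in\Omega\cap\mathrm{dom}\,\varphi$): - $(G_\varphi,\nu,\Omega)$-(cor-EB): $\inf_{x_p\in\mathcal{P}_\varphi(x)}\langle G_\varphi(x),x-x_p\rangle\ge\nu\, d^2(x,\mathrm{crit}\,\varphi)$; - $(G_\varphi,\beta,\Omega)$-(cor-res-EB): $\inf_{x_p\in\mathcal{P}_\varphi(x)}\langle G_\varphi(x),x-x_p\rangle\ge\beta\|G_\varphi(x)\|^2$.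
   Formalization: In (i) the iterates x_k are also assumed to lie in dom φ; otherwise (i) fails, e.g. for φ the indicator of {0} on ℝ, X = Ω = ℝ, G(x) = −x, since the error bounds are required only on Ω ∩ dom φ. *)

(* Defs.v *)
From HB Require Import structures.
From mathcomp Require Import all_boot all_order all_algebra.
From mathcomp Require Import all_classical all_reals all_analysis.

Set Implicit Arguments.
Unset Strict Implicit.
Unset Printing Implicit Defensive.

Import Order.TTheory GRing.Theory Num.Theory.
Import numFieldNormedType.Exports.

Local Open Scope classical_set_scope.
Local Open Scope ring_scope.

Section Defs.
Context {R : realType} {n : nat}.
Implicit Types (phi : 'rV[R]_n -> \bar R) (G : 'rV[R]_n -> 'rV[R]_n).
Implicit Types (X Omega Q : set 'rV[R]_n) (u v x y : 'rV[R]_n).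

Definition dot u v : R := \sum_(i < n) u 0 i * v 0 i.

(* The library's norm `|u| on row vectors is the sup norm, hence this
   definition. Both norms induce the topology used below. *)
Definition enorm u : R := Num.sqrt (dot u u).

(* Meaningful for nonempty Q only: the real [inf] of the empty set is 0. *)
Definition dist_to Q x : R := inf [set enorm (x - y) | y in Q].

Definition edom phi : set 'rV[R]_n := [set x | (phi x < +oo)%E].

Definition proper_lsc phi : Prop :=
  [/\ forall x, phi x != -oo%E, edom phi !=set0 & lower_semicontinuous phi].

Definition achieves_min phi : Prop := exists x, forall y, (phi x <= phi y)%E.

(* Empty outside the domain; the lower limit is over y -> x with y != x. *)
Definition frechet_subdiff phi x : set 'rV[R]_n := [set v |
  edom phi x /\
  (0 <= limf_einf
     (fun y => (phi y - phi x - (dot v (y - x))%:E) * ((enorm (y - x))^-1)%:E)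
     x^')%E].

(* Empty outside the domain. *)
Definition limiting_subdiff phi x : set 'rV[R]_n := [set v |
  edom phi x /\
  exists x_ v_ : nat -> 'rV[R]_n,
    [/\ x_ @ \oo --> x, phi \o x_ @ \oo --> phi x,
        forall k, frechet_subdiff phi (x_ k) (v_ k) & v_ @ \oo --> v]].

Definition crit phi : set 'rV[R]_n := [set x | limiting_subdiff phi x 0].

Definition crit_proj phi x : set 'rV[R]_n := [set u |
  crit phi u /\ forall v, crit phi v -> enorm (x - u) <= enorm (x - v)].

(* A map X -> R^n is represented by a total function, of which only the values
   on X are meaningful. *)
Definition residual_measure phi X G : Prop :=
  [set x | X x /\ G x = 0] = crit phi.

Definition corr phi G x : \bar R :=
  ereal_inf [set (dot (G x) (x - p))%:E | p in crit_proj phi x].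

Definition cor_EB phi G (nu : R) Omega : Prop :=
  0 < nu /\ forall x, (Omega `&` edom phi) x ->
    ((nu * dist_to (crit phi) x ^+ 2)%:E <= corr phi G x)%E.

Definition cor_res_EB phi G (beta : R) Omega : Prop :=
  0 < beta /\ forall x, (Omega `&` edom phi) x ->
    ((beta * enorm (G x) ^+ 2)%:E <= corr phi G x)%E.

Definition gradient_method G (h : R) (x : nat -> 'rV[R]_n) : Prop :=
  forall k, x k.+1 = x k - h *: G (x k).

Definition linear_convergence phi (tau : R) (x : nat -> 'rV[R]_n) : Prop :=
  forall k, dist_to (crit phi) (x k.+1) ^+ 2
            <= tau * dist_to (crit phi) (x k) ^+ 2.

End Defs.

Definition admissible {R : realType} (beta nu h tau theta : R) : Prop :=
  [/\ 0 < h, 0 < tau < 1, 0 < theta < 1,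
      (1 - tau) / (2 * theta * nu) <= h <= 2 * (1 - theta) * beta
    & 1 - 4 * theta * (1 - theta) * beta * nu <= tau].

(* Main.v *)
Require Import Defs.
From HB Require Import structures.
From mathcomp Require Import all_boot all_order all_algebra.
From mathcomp Require Import ring lra.
From mathcomp Require Import all_classical all_reals all_analysis.

Set Implicit Arguments.
Unset Strict Implicit.
Unset Printing Implicit Defensive.

Import Order.TTheory GRing.Theory Num.Theory.
Import numFieldNormedType.Exports.

Local Open Scope classical_set_scope.
Local Open Scope ring_scope.

(** Fix an iterate [x], write [g] for its residual [G x], [d] for its distance
    to the critical set and [p] for a nearest critical point, and put
    [c = dot g (x - p)].

    Part (i). Expanding the square, the next iterate [x - h g] is at squared
    distance [d ^ 2 - 2 h c + h ^ 2 |g| ^ 2] from [p] ([enorm_sub_scale]), and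
    [p] bounds from above its distance to the critical set. The two error
    bounds say [nu d ^ 2 <= c] and [beta |g| ^ 2 <= c]; [theta] splits the
    linear gain [2 h c] between them: the share [1 - theta] absorbs
    [h ^ 2 |g| ^ 2] as long as [h <= 2 (1 - theta) beta], and the share [theta]
    contracts [d ^ 2] by the factor [1 - 2 h theta nu <= tau]
    ([gradient_step_contraction]). A nearest point exists because the critical
    set is closed and closed balls are compact ([nearest_point_exists]). The
    rate cannot be better than [1 - beta nu] because [4 theta (1 - theta) <= 1],
    with equality at [theta = 1 / 2].

    Part (ii). The distance to a set is 1-Lipschitz ([dist_to_lipschitz]) and
    a step moves the iterate by [h |g|], so a step that shrinks the distance by
    the factor [sqrt tau] has length at least [(1 - sqrt tau) d]. This bounds
    [|g|] from below by a multiple of [d], and the residual error bound turns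
    [beta |g| ^ 2] into a lower bound of the correlation. *)

(** * Euclidean geometry of row vectors *)

Section Euclidean.
Context {R : realType} {n : nat}.
Implicit Types u v x y g p : 'rV[R]_n.

Lemma dotvv_ge0 u : 0 <= dot u u.
Proof. by apply: sumr_ge0 => i _; rewrite -expr2 sqr_ge0. Qed.

Lemma enorm_ge0 u : 0 <= enorm u.
Proof. exact: sqrtr_ge0. Qed.

Lemma sqr_enorm u : enorm u ^+ 2 = dot u u.
Proof. by rewrite sqr_sqrtr ?dotvv_ge0. Qed.

Lemma dot0_eq0 u : dot u u = 0 -> u = 0.
Proof.
move=> /psumr_eq0P u0; apply/rowP => i; apply/eqP.
by rewrite mxE -sqrf_eq0 expr2 u0 // => j _; rewrite -expr2 sqr_ge0.
Qed.

Lemma coord_le_enorm u i : `|u 0 i| <= enorm u.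
Proof.
rewrite -sqrtr_sqr ler_wsqrtr // /dot (bigD1 i) //= -expr2 lerDl.
by apply: sumr_ge0 => j _; rewrite -expr2 sqr_ge0.
Qed.

Lemma enorm_sub_scale u v (t : R) :
  enorm (u - t *: v) ^+ 2
  = enorm u ^+ 2 - 2 * t * dot u v + t ^+ 2 * enorm v ^+ 2.
Proof.
rewrite !sqr_enorm /dot !mulr_sumr -sumrB -big_split /=.
by apply: eq_bigr => i _; rewrite !mxE; ring.
Qed.

Lemma dotC u v : dot u v = dot v u.
Proof. by apply: eq_bigr => i _; rewrite mulrC. Qed.

Lemma cauchy_schwarz u v : dot u v <= enorm u * enorm v.
Proof.
apply: le_trans (ler_norm _) _.
rewrite -(@ler_pXn2r _ 2) ?nnegrE ?mulr_ge0 ?enorm_ge0 //.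
rewrite exprMn real_normK ?num_real //.
have [v0|v_neq0] := eqVneq (dot v v) 0.
  have -> : dot u v = 0.
    by rewrite /dot big1 // => i _; rewrite (dot0_eq0 v0) mxE mulr0.
  by rewrite expr0n /= mulr_ge0 ?sqr_ge0.
have v_gt0 : 0 < dot v v by rewrite lt_neqAle eq_sym v_neq0 dotvv_ge0.
(* The square of the component of u orthogonal to v is nonnegative. *)
have := sqr_ge0 (enorm (u - (dot u v / dot v v) *: v)).
rewrite enorm_sub_scale !sqr_enorm -(pmulr_lge0 _ v_gt0).
suff -> : (dot u u - 2 * (dot u v / dot v v) * dot u v
           + (dot u v / dot v v) ^+ 2 * dot v v) * dot v v
          = dot u u * dot v v - dot u v ^+ 2 by rewrite subr_ge0.
by field.
Qed.

Lemma enorm_triangle u v : enorm (u + v) <= enorm u + enorm v.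
Proof.
rewrite -(@ler_pXn2r _ 2) ?nnegrE ?addr_ge0 ?enorm_ge0 //.
have -> : u + v = u - (-1) *: v by rewrite scaleN1r opprK.
rewrite enorm_sub_scale; have := cauchy_schwarz u v; lra.
Qed.

Lemma enormZ (t : R) u : enorm (t *: u) = `|t| * enorm u.
Proof.
rewrite /enorm -sqrtr_sqr -sqrtrM ?sqr_ge0 //; congr Num.sqrt.
by rewrite /dot mulr_sumr; apply: eq_bigr => i _; rewrite !mxE; ring.
Qed.

Lemma enorm_continuous : continuous (@enorm R n).
Proof.
move=> x; apply: continuous_comp; last exact: sqrt_continuous.
apply: continuous_big; first exact: add_continuous.
by move=> i _ y; apply: continuousM; exact: coord_continuous.
Qed.

End Euclidean.

(** * Distance to a set and nearest points *)

Section Distance.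
Context {R : realType} {n : nat}.
Implicit Types (Q : set 'rV[R]_n) (x y p : 'rV[R]_n).

(** A minimizing sequence stays in the ball around [x] through any given point
    of [Q]; that part of [Q] is a closed subset of a product of segments, hence
    compact. *)
Lemma nearest_point_exists Q x : closed Q -> Q !=set0 ->
  exists p, Q p /\ forall q, Q q -> enorm (x - p) <= enorm (x - q).
Proof.
move=> Qcl [q0 Qq0]; pose f y := enorm (x - y).
have fc : continuous f.
  move=> y; apply: (@continuous_comp _ _ _ (fun z : 'rV[R]_n => x - z)).
    exact: (@cvgB R 'rV[R]_n _ (nbhs y) _ (cst x) id x y (cvg_cst x) cvg_id).
  exact: enorm_continuous.
pose K := Q `&` f @^-1` [set r | r <= f q0].
have Kcl : closed K.
  apply: closedI => //; apply: preimage_closed; last exact: closed_le.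
  by move=> y _; exact: fc.
pose box := [set y : 'rV[R]_n |
  forall i, y ord0 i \in `[x 0 i - f q0, x 0 i + f q0]].
have Kcpt : compact K.
  apply: (@subclosed_compact _ _ box) => //.
    apply: (@rV_compact _ _ (fun i => [set` `[x 0 i - f q0, x 0 i + f q0]])).
    by move=> i; exact: segment_compact.
  move=> y [_ yr] i; rewrite in_itv /= -ler_distlC.
  by have := le_trans (coord_le_enorm (x - y) i) yr; rewrite !mxE.
have K0 : K !=set0 by exists q0; split => //=.
have [p /set_mem[Qp pr] pmin] :=
  compact_EVT_min K0 Kcpt (continuous_subspaceT fc).
exists p; split=> // q Qq; have [qr|qr] := leP (f q) (f q0).
  by apply: pmin; apply/mem_set.
by apply: le_trans pr _; exact: ltW.
Qed.

Lemma dist_to_le Q x q : Q q -> dist_to Q x <= enorm (x - q).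
Proof.
move=> Qq; apply: ge_inf; last by exists q.
by exists 0 => _ [y _ <-]; exact: enorm_ge0.
Qed.

Lemma le_dist_to Q x (r : R) : Q !=set0 ->
  (forall q, Q q -> r <= enorm (x - q)) -> r <= dist_to Q x.
Proof.
move=> [q Qq] rQ; apply: lb_le_inf; first by exists (enorm (x - q)), q.
by move=> _ [y Qy <-]; exact: rQ.
Qed.

Lemma dist_to_ge0 Q x : Q !=set0 -> 0 <= dist_to Q x.
Proof. by move=> Q0; apply: le_dist_to => // q _; exact: enorm_ge0. Qed.

Lemma dist_to_nearest Q x p : Q p ->
  (forall q, Q q -> enorm (x - p) <= enorm (x - q)) ->
  dist_to Q x = enorm (x - p).
Proof.
move=> Qp pmin; apply/eqP; rewrite eq_le dist_to_le //=.
by apply: le_dist_to => //; exists p.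
Qed.

Lemma dist_to_lipschitz Q x y : Q !=set0 ->
  dist_to Q x <= dist_to Q y + enorm (x - y).
Proof.
move=> Q0; rewrite -lerBlDr; apply: le_dist_to => // q Qq.
rewrite lerBlDr; apply: le_trans (dist_to_le x Qq) _.
have -> : x - q = (y - q) + (x - y) by rewrite [RHS]addrC subrKA.
exact: enorm_triangle.
Qed.

End Distance.

(** * One step of the method *)

Section Step.
Context {R : realType} {n : nat}.
Variables (phi : 'rV[R]_n -> \bar R) (G : 'rV[R]_n -> 'rV[R]_n).
Hypotheses (crit_neq0 : crit phi !=set0) (crit_closed : closed (crit phi)).
Local Notation d := (dist_to (crit phi)).

(** The squared distance from the next iterate to [p] carries the factor
    [1 - 2 h theta nu]; requiring it to be at most [tau] and solving for [h]
    gives the lower end of the admissible step sizes. *)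
Lemma gradient_step_contraction (beta nu h tau theta : R) x :
  0 < h -> 0 <= theta <= 1 -> 1 - 2 * h * theta * nu <= tau ->
  h <= 2 * (1 - theta) * beta ->
  ((nu * d x ^+ 2)%:E <= corr phi G x)%E ->
  ((beta * enorm (G x) ^+ 2)%:E <= corr phi G x)%E ->
  d (x - h *: G x) ^+ 2 <= tau * d x ^+ 2.
Proof.
move=> h0 /andP[th0 th1] htau hbeta EB resEB.
have [p [Cp pmin]] := nearest_point_exists x crit_closed crit_neq0.
have corr_le : (corr phi G x <= (dot (G x) (x - p))%:E)%E.
  by apply: ereal_inf_lbound; exists p.
have := le_trans EB corr_le; have := le_trans resEB corr_le.
rewrite !lee_fin => le_c1 le_c2.
have : d (x - h *: G x) ^+ 2 <= enorm (x - p - h *: G x) ^+ 2.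
  rewrite ler_pXn2r ?nnegrE ?dist_to_ge0 ?enorm_ge0 // addrAC.
  exact: dist_to_le.
move=> /le_trans; apply.
rewrite enorm_sub_scale -(dist_to_nearest Cp pmin) dotC.
have share_nu : 2 * h * theta * (nu * d x ^+ 2)
    <= 2 * h * theta * dot (G x) (x - p).
  by rewrite ler_wpM2l // !mulr_ge0 // ltW.
have share_beta : h * (2 * (1 - theta) * (beta * enorm (G x) ^+ 2))
    <= h * (2 * (1 - theta) * dot (G x) (x - p)).
  by rewrite ler_pM2l // ler_wpM2l // mulr_ge0 ?subr_ge0.
have step_length : h * (h * enorm (G x) ^+ 2)
    <= h * (2 * (1 - theta) * beta * enorm (G x) ^+ 2).
  by rewrite ler_pM2l // ler_wpM2r ?sqr_ge0.
have rate : (1 - 2 * h * theta * nu) * d x ^+ 2 <= tau * d x ^+ 2.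
  by rewrite ler_wpM2r ?sqr_ge0.
lra.
Qed.

(** The distance is 1-Lipschitz, hence it cannot drop by more than the length
    [h |G x|] of the step. *)
Lemma residual_ge_dist (h s : R) x : 0 < h ->
  d (x - h *: G x) <= s * d x -> (1 - s) * d x <= h * enorm (G x).
Proof.
move=> h0 dle; have := dist_to_lipschitz x (x - h *: G x) crit_neq0.
rewrite subKr enormZ gtr0_norm //; lra.
Qed.

End Step.

Theorem theorem2 (R : realType) (n : nat) (phi : 'rV[R]_n -> \bar R)
    (X Omega : set 'rV[R]_n) (G : 'rV[R]_n -> 'rV[R]_n) (beta : R)
    (phi_Gamma : proper_lsc phi) (phi_min : achieves_min phi)
    (crit_neq0 : crit phi !=set0) (crit_closed : closed (crit phi))
    (Omega_sub : Omega `<=` X) (G_res : residual_measure phi X G)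
    (phi_res_EB : cor_res_EB phi G beta Omega) :
  (* (i) *)
  (forall nu : R, cor_EB phi G nu Omega -> nu < 1 / beta ->
    (forall h tau theta : R, admissible beta nu h tau theta ->
      forall x : nat -> 'rV[R]_n, gradient_method G h x ->
        (forall k, Omega (x k)) -> (forall k, edom phi (x k)) ->
        linear_convergence phi tau x) /\
    (admissible beta nu beta (1 - beta * nu) (1 / 2) /\
     forall h tau theta : R, admissible beta nu h tau theta ->
       1 - beta * nu <= tau)) /\
  (* (ii) *)
  (forall h tau : R, 0 < h -> 0 < tau < 1 ->
    (forall x : nat -> 'rV[R]_n, gradient_method G h x -> Omega (x 0%N) ->
      forall k, Omega (x k)) ->
    (forall x : nat -> 'rV[R]_n, gradient_method G h x -> Omega (x 0%N) ->
      linear_convergence phi tau x) ->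
    cor_EB phi G (beta * (1 - Num.sqrt tau) ^+ 2 / h ^+ 2) Omega).
Proof.
have [beta0 resEB] := phi_res_EB; split.
  move=> nu [nu0 EB] nub.
  have bn1 : beta * nu < 1 by rewrite mulrC -ltr_pdivlMr.
  have bn0 : 0 < beta * nu by exact: mulr_gt0.
  split.
    move=> h tau theta [h0 _ /andP[th0 th1] /andP[hlo hhi] _] x xG xOm xdom k.
    rewrite xG; apply: (gradient_step_contraction crit_neq0 crit_closed
      (beta := beta) (nu := nu) (theta := theta)) => //.
    - by rewrite !ltW.
    - move: hlo; rewrite ler_pdivrMr; last by rewrite !mulr_gt0.
      lra.
    - by apply: EB.
    - by apply: resEB.
  split.
    split=> //; first by lra.
    - by lra.
    - rewrite (_ : (1 - _) / _ = beta); last by field; lra.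
      by apply/andP; split; lra.
    - by lra.
  move=> h tau theta [_ _ _ _ le_tau].
  (* 4 theta (1 - theta) is at most 1, being 1 - (1 - 2 theta) ^ 2. *)
  have : 0 <= (1 - 2 * theta) ^+ 2 * (beta * nu).
    by rewrite mulr_ge0 ?sqr_ge0 // ltW.
  lra.
move=> h tau h0 /andP[tau0 tau1] _ lin; split.
  rewrite divr_gt0 ?exprn_gt0 // mulr_gt0 // exprn_gt0 // subr_gt0.
  by rewrite -[ltRHS]sqrtr1 ltr_sqrt.
move=> x Hx; apply: le_trans (resEB x Hx); rewrite lee_fin.
have [Ox _] := Hx.
pose step z := z - h *: G z.
have step_le : dist_to (crit phi) (step x) <= Num.sqrt tau * dist_to (crit phi) x.
  rewrite -(@ler_pXn2r _ 2) ?nnegrE ?mulr_ge0 ?sqrtr_ge0 ?dist_to_ge0 //.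
  rewrite exprMn sqr_sqrtr; last exact: ltW.
  exact: (lin (fun k => iter k step x) _ Ox 0%N).
have sqrt_lt1 : Num.sqrt tau < 1 by rewrite -[ltRHS]sqrtr1 ltr_sqrt.
have gd := residual_ge_dist crit_neq0 h0 step_le.
have gd2 : ((1 - Num.sqrt tau) * dist_to (crit phi) x) ^+ 2
    <= (h * enorm (G x)) ^+ 2.
  rewrite ler_pXn2r ?nnegrE // mulr_ge0 ?enorm_ge0 ?dist_to_ge0 ?subr_ge0 //.
  - exact: ltW.
  - exact: ltW.
rewrite mulrAC ler_pdivrMr ?exprn_gt0 //.
have := ler_wpM2l (ltW beta0) gd2; rewrite !exprMn; lra.
Qed.
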